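(* Let $(\Omega,\mathcal{F})$ be a measurable space, let $E$ be an equivalence relation on $\Omega$ and $\mathcal{G}$ a sub-$\sigma$-algebra of $\mathcal{F}$ such that the pair $(E,\mathcal{G})$ satisfies strong duality, and let $\mathbb{P},\mathbb{P}'\in\mathcal{P}(\Omega,\mathcal{F})$. Then a coupling $\tilde{\mathbb{P}}\in\Pi(\mathbb{P},\mathbb{P}')$ is $(E,\mathcal{G})$-optimal if and only if the measures $\tilde{\mathbb{P}}(\,\cdot\setminus E)\circ\pi^{-1}$ and $\tilde{\mathbb{P}}(\,\cdot\setminus E)\circ(\pi')^{-1}$ are mutually singular on $(\Omega,\mathcal{G})$.
   Context: $\mathcal{P}(\Omega,\mathcal{F})$ is the set of probability measures on $(\Omega,\mathcal{F})$, and $\Pi(\mathbb{P},\mathbb{P}')$ is the set of couplings, i.e. probability measures on $(\Omega\times\Omega,\mathcal{F}\otimes\mathcal{F})$ with first marginal $\mathbb{P}$ and second marginal $\mathbb{P}'$. The pair $(E,\mathcal{G})$ satisfies strong duality if $E\in\mathcal{F}\otimes\mathcal{F}$ and, for all $\mathbb{P},\mathbb{P}'\in\mathcal{P}(\Omega,\mathcal{F})$, $$\max_{A\in\mathcal{G}}|\mathbb{P}(A)-\mathbb{P}'(A)|=\min_{\tilde{\mathbb{P}}\in\Pi(\mathbb{P},\mathbb{P}')}(1-\tilde{\mathbb{P}}(E)),$$ where max and min assert that the supremum and infimum are both attained. A coupling $\tilde{\mathbb{P}}\in\Pi(\mathbb{P},\mathbb{P}')$ is $(E,\mathcal{G})$-optimal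 if $1-\tilde{\mathbb{P}}(E)=\sup_{A\in\mathcal{G}}|\mathbb{P}(A)-\mathbb{P}'(A)|$. The maps $\pi,\pi':\Omega\times\Omega\to\Omega$ are the first and second coordinate projections, so $(\tilde{\mathbb{P}}(\,\cdot\setminus E)\circ\pi^{-1})(A)=\tilde{\mathbb{P}}((A\times\Omega)\setminus E)$ and $(\tilde{\mathbb{P}}(\,\cdot\setminus E)\circ(\pi')^{-1})(A)=\tilde{\mathbb{P}}((\Omega\times A)\setminus E)$. Mutually singular on $(\Omega,\mathcal{G})$ means that there is $A\in\mathcal{G}$ such that one of the two measures vanishes on $A$ and the other vanishes on $\Omega\setminus A$. *)

(* Defs.v *)
From mathcomp Require Import all_boot all_order all_algebra.
From mathcomp Require Import all_classical all_reals all_analysis.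

Set Implicit Arguments.
Unset Strict Implicit.
Unset Printing Implicit Defensive.

Import Order.TTheory GRing.Theory Num.Theory.

Local Open Scope classical_set_scope.
Local Open Scope ereal_scope.

Definition sub_sigma_algebra_of d (T : measurableType d) (G : set (set T)) : Prop :=
  sigma_algebra setT G /\ G `<=` measurable.

Definition equivalence_relation_set (T : Type) (E : set (T * T)) : Prop :=
  RelationClasses.Equivalence (fun x y : T => E (x, y)).

(* Measures of the library are functions on all sets whose values outside the
   sigma-algebra carry no meaning, so marginals are compared on measurable
   sets only. *)
Definition couplings d (T : measurableType d) (R : realType)
    (P P' : probability T R) : set (probability (T * T)%type R) :=
  [set Q : probability (T * T)%type R | forall A : set T, measurable A ->
     pushforward Q fst A = P A /\ pushforward Q snd A = P' A].

Definition discrepancies d (T : measurableType d) (R : realType)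
    (G : set (set T)) (P P' : probability T R) : set (\bar R) :=
  [set `|P A - P' A| | A in G].

Definition coupling_costs d (T : measurableType d) (R : realType)
    (E : set (T * T)) (P P' : probability T R) : set (\bar R) :=
  [set 1 - Q E | Q in couplings P P'].

(* The two memberships say that the supremum and the infimum are attained. *)
Definition strong_duality d (T : measurableType d) (R : realType)
    (E : set (T * T)) (G : set (set T)) : Prop :=
  measurable E /\
  forall P P' : probability T R,
    [/\ discrepancies G P P' (ereal_sup (discrepancies G P P')),
        coupling_costs E P P' (ereal_inf (coupling_costs E P P')) &
        ereal_sup (discrepancies G P P') = ereal_inf (coupling_costs E P P')].

Definition optimal_coupling d (T : measurableType d) (R : realType)
    (E : set (T * T)) (G : set (set T)) (P P' : probability T R)
    (Q : probability (T * T)%type R) : Prop :=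
  couplings P P' Q /\ 1 - Q E = ereal_sup (discrepancies G P P').

Definition measure_off (T : Type) (R : realType) (mu : set T -> \bar R)
  (E : set T) : set T -> \bar R := fun C => mu (C `\` E).

Definition mutually_singular_on (T : Type) (R : realType) (G : set (set T))
    (mu nu : set T -> \bar R) : Prop :=
  exists2 A, G A & (mu A = 0 /\ nu (~` A) = 0) \/ (nu A = 0 /\ mu (~` A) = 0).

(* Main.v *)
(** Applying duality to Dirac masses shows that every [A] in [G] is saturated
    for [E].  Hence the part of a coupling [Q] that lives on [E] contributes
    equally to [P A] and [P' A], and [P A - P' A = mu A - nu A], where [mu] and
    [nu] are the marginals of [Q] off [E].  Both have total mass
    [c = 1 - Q E], so [|mu A - nu A| = c] exactly when [A] or its complement
    separates [mu] from [nu]; duality identifies [c] with the maximal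
    discrepancy. *)
Require Import Defs.
From mathcomp Require Import all_boot all_order all_algebra.
From mathcomp Require Import all_classical all_reals all_analysis.
From mathcomp Require Import lra.

Import Order.TTheory GRing.Theory Num.Theory.

Local Open Scope classical_set_scope.
Local Open Scope ereal_scope.

Lemma dirac_coupling (R : realType) (d : measure_display)
    (T : measurableType d) (x y : T) :
  couplings (dirac x : probability T R) (dirac y : probability T R)
    (dirac (x, y) : probability (T * T)%type R).
Proof. by move=> A _. Qed.

(** When [E (x, y)] holds, the Dirac mass at [(x, y)] is a coupling of cost 0. Duality then bounds
    the discrepancy at [A] by 0, so the indicator of [A] agrees at [x] and [y]. *)
Lemma strong_duality_saturated (R : realType) (d : measure_display)
    (T : measurableType d) (E : set (T * T)) (G : set (set T)) (A : set T)
    (x y : T) :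
  strong_duality R E G -> G A -> E (x, y) -> A x <-> A y.
Proof.
move=> [_ /(_ (dirac x : probability T R) (dirac y : probability T R))].
move=> [_ _ sup_inf] GA Exy.
have cost0 : ereal_inf (coupling_costs E (dirac x : probability T R)
                         (dirac y : probability T R)) <= 0.
  apply: ereal_inf_lbound; exists (dirac (x, y) : probability (T * T)%type R).
    exact: dirac_coupling.
  by rewrite /= /dirac indicE mem_set// subee.
have : `|(dirac x A : \bar R) - dirac y A| <= 0.
  apply: le_trans cost0; rewrite -sup_inf.
  by apply: ereal_sup_ubound; exists A.
rewrite !diracE -EFinB abse_EFin lee_fin normr_le0 subr_eq0 eqr_nat.
case: (boolP (x \in A)) (boolP (y \in A)) => [xA|xA] [yA|yA] //= _.
- by split=> _; exact: set_mem.
- by split=> /mem_set; rewrite ?(negPf xA) ?(negPf yA).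
Qed.

Arguments strong_duality_saturated {R d T E G A x y}.

(** All masses are expressed through three real numbers, so that both directions of the equivalence
    become linear arithmetic. *)
Lemma off_marginals (R : realType) (d : measure_display)
    (T : measurableType d) (E : set (T * T)) (A : set T)
    (P P' : probability T R) (Q : probability (T * T)%type R) :
  measurable E -> measurable A -> couplings P P' Q ->
  (forall x y, E (x, y) -> A x <-> A y) ->
  let mu := pushforward (measure_off Q E) fst in
  let nu := pushforward (measure_off Q E) snd in
  exists a b c : R,
    [/\ mu A = a%:E, mu (~` A) = (c - a)%:E,
        nu A = b%:E, nu (~` A) = (c - b)%:E &
     [/\ 1 - Q E = c%:E, P A - P' A = (a - b)%:E,
        (0 <= a <= c)%R & (0 <= b <= c)%R]].
Proof.
move=> mE mA hQ sat mu nu.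
have mfst B : measurable B -> measurable (fst @^-1` B : set (T * T)).
  by move=> mB; rewrite -[_ @^-1` _]setTI; exact: measurable_fst.
have msnd B : measurable B -> measurable (snd @^-1` B : set (T * T)).
  by move=> mB; rewrite -[_ @^-1` _]setTI; exact: measurable_snd.
have Qoff X : measurable X -> Q X = Q (X `\` E) + Q (X `&` E).
  by move=> mX; rewrite -measureDI.
have Qfin X : measurable X -> Q X = (fine (Q X))%:E.
  by move=> mX; rewrite fineK// fin_num_measure.
have mCE : measurable (~` E) by exact: measurableC.
have QCE : 1 - Q E = Q (~` E) by rewrite probability_setC.
have splitC X : measurable X ->
    Q (~` E) = Q (X `\` E) + Q (~` X `\` E).
  move=> mX; rewrite (measureDI Q mCE mX) addeC; congr (Q _ + Q _).
    by rewrite setIC.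
  by rewrite !setDE setIC.
(* By saturation the two cylinders over [A] coincide inside [E]; their common mass cancels in
   [P A - P' A]. *)
have satE : fst @^-1` A `&` E = snd @^-1` A `&` E.
  by apply/seteqP; split=> -[x y] /= [Az Exy]; split=> //; apply/(sat _ _ Exy).
have [PA P'A] := hQ _ mA.
have mX := mfst _ mA; have mY := msnd _ mA.
have moff X : measurable X -> measurable (X `\` E) by move=> ?; exact: measurableD.
have mXo := moff _ mX; have mYo := moff _ mY.
have mXc := moff _ (measurableC mX); have mYc := moff _ (measurableC mY).
have mYE : measurable (snd @^-1` A `&` E) by exact: measurableI.
have sX := splitC _ mX; have sY := splitC _ mY.
move: (Qoff _ mX) (Qoff _ mY); rewrite satE => oX oY.
exists (fine (mu A)), (fine (nu A)), (fine (Q (~` E))).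
rewrite QCE -PA -P'A /mu /nu /pushforward /measure_off -!preimage_setC oX oY.
move: sX sY.
(* Nonnegativity on the cylinders over [A] gives the lower bounds on [a] and [b]; on their
   complements it gives the upper bounds by [c]. *)
have fge0 X : (0 <= fine (Q X))%R by exact/fine_ge0/measure_ge0.
have := fge0 (fst @^-1` A `\` E).
have := fge0 (snd @^-1` A `\` E).
have := fge0 (~` (fst @^-1` A) `\` E).
have := fge0 (~` (snd @^-1` A) `\` E).
rewrite (Qfin _ mXo) (Qfin _ mYo) (Qfin _ mXc) (Qfin _ mYc) (Qfin _ mYE).
rewrite (Qfin _ mCE) /= -!EFinD => h1 h2 h3 h4 [sX] [sY].
split=> //; try by congr _%:E; lra.
by split=> //; first (by congr _%:E; lra); apply/andP; split; lra.
Qed.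

Arguments off_marginals {R d T E A P P' Q}.

Theorem proposition3p12 (R : realType) (d : measure_display)
    (T : measurableType d) (E : set (T * T)) (G : set (set T))
    (hE : equivalence_relation_set E)
    (hG : sub_sigma_algebra_of G)
    (hEG : strong_duality R E G)
    (P P' : probability T R)
    (Q : probability (T * T)%type R) (hQ : couplings P P' Q) :
  optimal_coupling E G P P' Q <->
  mutually_singular_on G (pushforward (measure_off Q E) fst)
                         (pushforward (measure_off Q E) snd).
Proof.
have [_ Gmeas] := hG.
have [mE /(_ P P')[sup_attained _ sup_inf]] := hEG.
have off A (GA : G A) := off_marginals mE (Gmeas A GA) hQ
  (fun _ _ => strong_duality_saturated hEG GA).
split=> [[_ opt]|[A GA sing]].
- move: sup_attained; rewrite -opt => -[A GA].
  have [a [b [c [muA muC nuA nuC [-> -> ac bc]]]]] := off A GA.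
  rewrite abse_EFin => -[abs_ab].
  (* Two points of [[0, c]] at distance [c] are its endpoints; the sign of [a - b] tells which
     measure vanishes on [A]. *)
  exists A => //; rewrite muA muC nuA nuC.
  case: (lerP b a) => ab.
    by right; split; congr _%:E; move: abs_ab; rewrite ger0_norm; lra.
  by left; split; congr _%:E; move: abs_ab; rewrite ltr0_norm; lra.
(* The singular set makes the cost of [Q] one of the discrepancies, hence at most their supremum.
   Conversely, this cost is at least the infimum of all costs, which duality equates with that
   supremum. *)
- split=> //; apply/eqP; rewrite eq_le; apply/andP; split.
    suff -> : 1 - Q E = `|P A - P' A| by apply: ereal_sup_ubound; exists A.
    have [a [b [c [muA muC nuA nuC [-> -> ac bc]]]]] := off A GA.
    move: sing; rewrite muA muC nuA nuC abse_EFin.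
    case=> -[[h1] [h2]]; congr _%:E.
      by rewrite ler0_norm; lra.
    by rewrite ger0_norm; lra.
  by rewrite sup_inf; apply: ereal_inf_lbound; exists Q.
Qed.
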